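(* Let $n\ge 2$ and $\lambda>0$. For each $k=1,\ldots,n$, let $\tau^k_1,\ldots,\tau^k_n$ be i.i.d. random variables with distribution $\mathrm{Erlang}(2,\lambda)$, and let $T_k=\frac{1}{n}\sum_{m=1}^n\tau^k_m-\frac{2}{\lambda}$. Then $$\Pr\left(\max_{1\le k\le n}|T_k|\le \frac{\ln n}{\lambda\sqrt n}\right)\ \ge\ \Psi(n),$$ where $$\Psi(n)=\max\left\{0,\ 1-\left(1-\frac{\ln n}{2\sqrt n}\right)^{2n}n^{1+\sqrt n}-\left(1+\frac{\ln n}{2\sqrt n}\right)^{2n}n^{1-\sqrt n}\right\}.$$ Moreover, $\Psi(n)\to 1$ as $n\to\infty$.
   Context: $\mathrm{Erlang}(2,\lambda)$ denotes the distribution of the sum of two independent exponential random variables with parameter $\lambda$. No independence between the families $(\tau^k_m)_m$ for different $k$ is assumed. *)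

(* Defs.v *)
From HB Require Import structures.
From mathcomp Require Import all_boot all_order all_algebra.
From mathcomp Require Import all_classical all_reals all_analysis.
Set Implicit Arguments. Unset Strict Implicit. Unset Printing Implicit Defensive.
Import Order.TTheory GRing.Theory Num.Theory.
Local Open Scope classical_set_scope.
Local Open Scope ring_scope.

(* density of Erlang(2, lam): lam^2 x e^{-lam x} on [0, +oo[, 0 elsewhere;
   this is the density of the sum of two independent Exp(lam) variables *)
Definition erlang2_pdf (R : realType) (lam : R) (x : R) : R :=
  if 0 <= x then lam ^+ 2 * x * expR (- lam * x) else 0.

Definition erlang2_distributed d (T : measurableType d) (R : realType)
  (P : probability T R) (X : {RV P >-> R}) (lam : R) : Prop :=
  forall A : set R, measurable A ->
    P (X @^-1` A) = (\int[lebesgue_measure]_(x in A) (erlang2_pdf lam x)%:E)%E.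

Definition mutually_independent d (T : measurableType d) (R : realType)
  (P : probability T R) (n : nat) (X : 'I_n -> {RV P >-> R}) : Prop :=
  forall B : 'I_n -> set R, (forall i, measurable (B i)) ->
    fine (P (\bigcap_(i in [set: 'I_n]) (X i @^-1` B i)))
    = \prod_(i < n) fine (P (X i @^-1` B i)).

Definition Psi (R : realType) (n : nat) : R :=
  let a := ln (n%:R : R) / (2 * Num.sqrt (n%:R : R)) in
  Num.max 0
    (1 - (1 - a) ^+ (2 * n) * (n%:R : R) `^ (1 + Num.sqrt (n%:R : R))
       - (1 + a) ^+ (2 * n) * (n%:R : R) `^ (1 - Num.sqrt (n%:R : R))).

(* Main.v *)
Require Import Defs.
From HB Require Import structures.
From mathcomp Require Import all_boot all_order all_algebra.
From mathcomp Require Import all_classical all_reals all_analysis.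
From mathcomp Require Import measurable_realfun.
From mathcomp Require Import ring lra.
Import Order.TTheory GRing.Theory Num.Theory numFieldNormedType.Exports.
Local Open Scope classical_set_scope.
Local Open Scope ring_scope.
Import HBNNSimple.

(* Chernoff's method and a union bound.  With a = ln n / (2 sqrt n), the event
   |T_k| > ln n / (lam sqrt n) says that S_k = sum_m tau^k_m exceeds
   2n(1 + a)/lam or falls below 2n(1 - a)/lam.  The moment generating function
   of S_k is (lam/(lam - s))^(2n) for s < lam, and the optimal choices
   s = lam a/(1 + a) and s = - lam a/(1 - a) give the tail bounds
   (1 + a)^(2n) e^(- 2na) and (1 - a)^(2n) e^(2na), where e^(2na) = n^(sqrt n).
   For the limit, 1 + a <= e^(a - a^2/8) and 1 - a <= e^(- a - a^2/8) bound each
   subtracted term of Psi by e^(L - L^2/16) with L = ln n, hence by 1/n as soon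
   as L >= 32. *)

(** * Weighted integrals and their values on indicators *)

(** Monotone convergence along the simple approximations of [g]. The limit involves [X] and [W] only
    through weighted integrals of indicators, so two such integrals that agree on indicators agree
    for every [g]. *)
Lemma ge0_integral_weighted_approx d d' (T : measurableType d)
    (T' : measurableType d') (R : realType) (mu : {measure set T -> \bar R})
    (X : T -> T') (W : T -> R) (g : T' -> R)
    (mg : measurable_fun [set: T'] (fun y => (g y)%:E)) :
  measurable_fun [set: T] X -> measurable_fun [set: T] W ->
  (forall x, 0 <= W x) -> (forall y, 0 <= g y) ->
  (\int[mu]_x (W x * g (X x))%:E =
   limn (fun n => \sum_(y \in range (nnsfun_approx measurableT mg n))
     (y%:E * \int[mu]_x
       (W x * \1_(nnsfun_approx measurableT mg n @^-1` [set y]) (X x))%:E)))%E.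
Proof.
move=> mX mW W0 g0; pose h := nnsfun_approx measurableT mg.
have mh n : measurable_fun setT (fun x => h n (X x)).
  by apply: measurableT_comp => //; exact: measurable_funP.
have mind n r : measurable_fun setT (fun x => \1_(h n @^-1` [set r]) (X x) : R).
  by apply: measurableT_comp => //; apply: measurable_indic.
have hge0 n (r : R) x : 0 <= r * \1_(h n @^-1` [set r]) x.
  by have := nnfun_muleindic_ge0 (h n) r x; rewrite -EFinM lee_fin.
transitivity (limn (fun n => \int[mu]_x (W x * h n (X x))%:E)%E).
  rewrite -monotone_convergence//.
  - apply: eq_integral => x _; apply/esym/cvg_lim => //.
    under eq_fun do rewrite EFinM.
    rewrite EFinM; apply: cvgeZl => //.
    apply: (@cvg_nnsfun_approx _ _ _ _ measurableT _ mg) => // z _.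
    by rewrite lee_fin.
  - by move=> n; apply/measurable_EFinP/measurable_funM.
  - by move=> n x _; rewrite lee_fin mulr_ge0.
  - move=> x _ m n mn; rewrite lee_fin ler_wpM2l//.
    exact/lefP/nd_nnsfun_approx.
congr (limn _); apply/funext => n.
transitivity (\int[mu]_x (\sum_(y \in range (h n))
    (W x * (y * \1_(h n @^-1` [set y]) (X x)))%:E))%E.
  apply: eq_integral => x _.
  rewrite fimfunE EFinM -fsumEFin//= ge0_mule_fsumr//.
  by move=> y; rewrite lee_fin hge0.
rewrite ge0_integral_fsum//.
(* Here [r] is a value of a nonnegative simple function, so it is nonnegative and can leave the
   integral. *)
- apply: eq_fsbigr => r; rewrite inE => -[z _ <-].
  under eq_integral do rewrite mulrCA EFinM.
  rewrite ge0_integralZl//.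
  + by apply/measurable_EFinP/measurable_funM.
  + by move=> x _; rewrite lee_fin mulr_ge0.
  + by rewrite lee_fin.
- by move=> r; apply/measurable_EFinP/measurable_funM => //;
    exact: measurable_funM.
- by move=> r x _; rewrite lee_fin mulr_ge0.
Qed.

(* Covers both densities ([m1] a probability, [W1 = 1], [Y = id] and [W2] the
   density) and independence ([W1] a product of functions of the other
   variables, [W2] the constant product of their expectations). *)
Lemma ge0_integral_weighted_transfer d d1 d2 (T : measurableType d)
    (T1 : measurableType d1) (T2 : measurableType d2) (R : realType)
    (m1 : {measure set T1 -> \bar R}) (m2 : {measure set T2 -> \bar R})
    (X : T1 -> T) (Y : T2 -> T) (W1 : T1 -> R) (W2 : T2 -> R) :
  measurable_fun [set: T1] X -> measurable_fun [set: T2] Y ->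
  measurable_fun [set: T1] W1 -> measurable_fun [set: T2] W2 ->
  (forall x, 0 <= W1 x) -> (forall x, 0 <= W2 x) ->
  (forall B, measurable B -> \int[m1]_x (W1 x * \1_B (X x))%:E
                           = \int[m2]_x (W2 x * \1_B (Y x))%:E)%E ->
  forall g : T -> R, measurable_fun [set: T] g -> (forall y, 0 <= g y) ->
  (\int[m1]_x (W1 x * g (X x))%:E = \int[m2]_x (W2 x * g (Y x))%:E)%E.
Proof.
move=> mX mY mW1 mW2 W10 W20 eqW g /measurable_EFinP mg g0.
rewrite !(ge0_integral_weighted_approx _ _ _ _ _ _ _ _ _ mg)//.
congr (limn _); apply/funext => n; apply: eq_fsbigr => r _.
by rewrite eqW.
Qed.

(** * Independence and expectations of products *)

(** A product of indicators is the indicator of the intersection of the preimages, so this is the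
    definition of independence. It starts the induction of the next lemma. *)
Lemma mutually_independent_indic_prod d (T : measurableType d) (R : realType)
    (P : probability T R) (n : nat) (X : 'I_n -> {RV P >-> R})
    (B : 'I_n -> set R) :
  mutually_independent X -> (forall i, measurable (B i)) ->
  (\int[P]_x (\prod_(i < n) \1_(B i) (X i x))%:E =
   \prod_(i < n) \int[P]_x (\1_(B i) (X i x) : R)%:E)%E.
Proof.
move=> indX mB.
have mXB i : measurable (X i @^-1` B i).
  by rewrite -[X in measurable X]setTI; exact: measurable_funP.
have intB i : (\int[P]_x (\1_(B i) (X i x) : R)%:E
    = (fine (P (X i @^-1` B i)))%:E)%E.
  rewrite (eq_integral (fun x => (\1_(X i @^-1` B i) x)%:E)) => [|x _].
    by rewrite integral_indic// setIT fineK// fin_num_measure.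
  by rewrite !indicE; congr (_ %:R%:E); apply/idP/idP; rewrite !inE.
under eq_bigr do rewrite intB.
rewrite prodEFin -indX//.
rewrite (eq_integral
    (fun x => (\1_(\bigcap_(i in [set: 'I_n]) (X i @^-1` B i)) x)%:E)) => [|x _].
  rewrite integral_indic//; last exact: fin_bigcap_measurable.
  rewrite setIT fineK// fin_num_measure//.
  exact: fin_bigcap_measurable.
rewrite indicE; have [xB|xNB] := boolP (x \in _).
  rewrite big1// => i _; rewrite indicE mem_set//.
  by move: xB; rewrite inE => /(_ i I).
have [i xi] : exists i, ~ B i (X i x).
  apply/existsNP => xB; move/negP: xNB; apply.
  by rewrite inE => i _; exact: xB.
by rewrite (bigD1 i)//= indicE memNset// mul0r.
Qed.

Lemma mutually_independent_ge0_integral_prod d (T : measurableType d)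
    (R : realType) (P : probability T R) (n : nat) (X : 'I_n -> {RV P >-> R})
    (g : 'I_n -> R -> R) :
  mutually_independent X ->
  (forall i, measurable_fun [set: R] (g i)) -> (forall i y, 0 <= g i y) ->
  (forall i, \int[P]_x (g i (X i x))%:E < +oo)%E ->
  (\int[P]_x (\prod_(i < n) g i (X i x))%:E =
   \prod_(i < n) \int[P]_x (g i (X i x))%:E)%E.
Proof.
move=> indX.
(* The indicators are replaced by arbitrary functions one index at a time. *)
suff claim (k : nat) : forall h : 'I_n -> R -> R,
    (forall i, measurable_fun [set: R] (h i)) -> (forall i y, 0 <= h i y) ->
    (forall i, \int[P]_x (h i (X i x))%:E < +oo)%E ->
    (forall i : 'I_n, (k <= i)%N ->
      exists2 B : set R, measurable B & h i = \1_B) ->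
    (\int[P]_x (\prod_(i < n) h i (X i x))%:E =
     \prod_(i < n) \int[P]_x (h i (X i x))%:E)%E.
  move=> mg g0 gfin; apply: (claim n) => // i.
  by rewrite leqNgt ltn_ord.
elim: k => [h mh h0 hfin hind|k IHk h mh h0 hfin hind].
  have /choice[B hB] : forall i, exists B : set R, measurable B /\ h i = \1_B.
    by move=> i; have [B mB ->] := hind i isT; exists B.
  have hE : h = fun i => \1_(B i) by apply/funext => i; exact: (hB i).2.
  by rewrite hE mutually_independent_indic_prod// => i; exact: (hB i).1.
(* If [n <= k], no index is at least [k] and the induction hypothesis applies to [h] itself. *)
have [nk|kn] := leqP n k.
  by apply: IHk => // i ki; have := leq_trans nk ki; rewrite leqNgt ltn_ord.
pose j := Ordinal kn.
have mhX i : measurable_fun setT (fun x => h i (X i x)).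
  by apply: measurableT_comp => //; exact: measurable_funP.
have h_fin i : (\int[P]_x (h i (X i x))%:E)%E \is a fin_num.
  by rewrite ge0_fin_numE// integral_ge0// => x _; rewrite lee_fin.
pose W x := \prod_(i < n | i != j) h i (X i x).
(* Since all expectations are finite, [c] is their true product and can serve as a real constant
   weight. *)
pose c := \prod_(i < n | i != j) fine (\int[P]_x (h i (X i x))%:E)%E.
have mW : measurable_fun setT W.
  rewrite (_ : W = fun x => \prod_(i < n) if i != j then h i (X i x) else 1);
    last by apply/funext => x; rewrite /W big_mkcond.
  apply: measurable_prod => i _.
  by case: (i != j).
have W0 x : 0 <= W x by apply: prodr_ge0.
have c0 : 0 <= c.
  apply: prodr_ge0 => i _; rewrite fine_ge0// integral_ge0// => x _.
  by rewrite lee_fin.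
have cE : (c%:E = \prod_(i < n | i != j) \int[P]_x (h i (X i x))%:E)%E.
  by rewrite -prodEFin; apply: eq_bigr => i _; rewrite fineK.
transitivity (\int[P]_x (W x * h j (X j x))%:E)%E.
  by apply: eq_integral => x _; rewrite (bigD1 j)//= mulrC.
(* Replacing the weight [W] by [c] amounts to factoring the expectation; it only has to be justified
   for indicators of [X j]. *)
rewrite (ge0_integral_weighted_transfer _ _ _ _ _ _ _ P P (X j) (X j)
  W (cst c))//=.
- under eq_integral do rewrite EFinM.
  rewrite ge0_integralZl//; last 2 first.
  + by apply/measurable_EFinP.
  + by move=> x _; rewrite lee_fin.
  by rewrite cE [RHS](bigD1 j)//= muleC.
- move=> B mB.
  have mBX i : measurable_fun setT (fun x => \1_B (X i x) : R).
    by apply: measurableT_comp => //; exact: measurable_indic.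
  (* With [h j] replaced by an indicator, every function from index [k] on is an indicator, as [IHk]
     requires. *)
  pose h' i := if i == j then \1_B else h i.
  have h'j : h' j = \1_B by rewrite /h' eqxx.
  have h'N i : i != j -> h' i = h i by rewrite /h' => /negPf ->.
  have := IHk h'.
  rewrite [in X in _ -> _ -> _ -> _ -> _ = X](bigD1 j)//= h'j.
  under [X in _ -> _ -> _ -> _ -> X = _]eq_integral do
    rewrite (bigD1 j)//= h'j.
  move=> IH.
  transitivity (\int[P]_x ((\1_B (X j x)) *
       (\prod_(i < n | i != j) (h' i (X i x))))%:E)%E.
    apply: eq_integral => x _; rewrite mulrC; congr (_ * _)%:E.
    by apply: eq_bigr => i /h'N ->.
  rewrite IH.
  + under [in RHS]eq_integral do rewrite EFinM.
    rewrite ge0_integralZl//; last by apply/measurable_EFinP.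
    rewrite muleC cE; congr (_ * _)%E.
    by apply: eq_bigr => i /h'N ->.
  + by move=> i; rewrite /h'; case: ifP.
  + by move=> i y; rewrite /h'; case: ifP.
  + move=> i; rewrite /h'; case: ifP => // _.
    apply: (@le_lt_trans _ _ (\int[P]_x 1)%E); last first.
      rewrite integral_cst// mul1e.
      exact: le_lt_trans (probability_le1 P measurableT) (ltry 1).
    apply: ge0_le_integral => //.
    * by apply/measurable_EFinP.
    * by move=> x _; rewrite lee_fin indicE; case: (_ \in _).
  + move=> i ki; rewrite /h'; case: eqP => [_|ij]; first by exists B.
    apply: hind; rewrite ltn_neqAle ki andbT; apply/eqP => ki'.
    by apply: ij; apply/val_inj.
Qed.

(** * The Erlang density and its moment generating function *)

Lemma measurable_erlang2_pdf (R : realType) (lam : R) :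
  measurable_fun [set: R] (erlang2_pdf lam).
Proof.
rewrite /erlang2_pdf; apply: measurable_fun_if => //.
- by apply: measurable_fun_ler => //; exact: measurable_cst.
- apply: measurable_funTS; apply: measurable_funM.
    by apply: measurable_funM.
  by apply: measurableT_comp.
Qed.

Lemma erlang2_pdf_ge0 (R : realType) (lam x : R) : 0 <= erlang2_pdf lam x.
Proof.
rewrite /erlang2_pdf; case: ifP => // x0.
by apply: mulr_ge0; rewrite ?expR_ge0// mulr_ge0// sqr_ge0.
Qed.

(** Half of the exponential absorbs the linear factor: 1 + x <= 2 (1 + x/2) <= 2 e^(x/2). *)
Lemma cvg_addr1_mul_expRN (R : realType) :
  (1 + x) * expR (- x) @[x --> +oo] --> (0 : R).
Proof.
apply: (@squeeze_cvgr _ _ _ R (cst 0) (fun x => 2 * expR (- (2^-1 * x)))).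
- near=> x; have x0 : 0 <= x by near: x; exact: nbhs_pinfty_ge.
  rewrite mulr_ge0 ?expR_ge0 ?addr_ge0//=.
  have -> : - x = - (2^-1 * x) + - (2^-1 * x) by field.
  rewrite expRD mulrA ler_wpM2r ?expR_ge0// expRN ler_pdivrMr ?expR_gt0//.
  by have := expR_ge1Dx (2^-1 * x); lra.
- exact: cvg_cst.
- rewrite -[X in _ --> X](mulr0 2); apply: cvgM; first exact: cvg_cst.
  apply: (@cvg_comp _ _ _ (fun x : R => 2^-1 * x) (fun z => expR (- z)) _
    (pinfty_nbhs R)); last exact: cvgr_expR.
  exact: gt0_cvgMry.
Unshelve. all: by end_near. Qed.

Lemma integral_mulr_expRN (R : realType) (c mu : R) : 0 <= c -> 0 < mu ->
  (\int[lebesgue_measure]_(x in `[0%R, +oo[) (c * x * expR (- (mu * x)))%:E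
   = (c / mu ^+ 2)%:E)%E.
Proof.
move=> c0 mu0; have mu_neq0 : mu != 0 by rewrite gt_eqF.
(* The antiderivative found by parts: it equals - c / mu^2 at 0 and tends to 0 at infinity. *)
pose F x : R := - (c / mu ^+ 2) * ((1 + mu * x) * expR (- (mu * x))).
have dF x : is_derive x (1 : R) F (c * x * expR (- (mu * x))).
  rewrite /F; apply: is_derive_eq.
  rewrite /GRing.scale /=.
  by field.
have cF : continuous F.
  by move=> x; apply/differentiable_continuous/derivable1_diffP; exact: ex_derive.
rewrite (@ge0_continuous_FTC2y _ _ F 0 0)//.
- by rewrite /F mulr0 oppr0 expR0 addr0 !mulr1 -EFinB sub0r opprK.
- by move=> x x0; rewrite !mulr_ge0 ?expR_ge0.
- apply: continuous_subspaceT => x.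
  apply: cvgM; first by apply: cvgM; [exact: cvg_cst|exact: cvg_id].
  apply: continuous_comp; last exact: continuous_expR.
  apply: cvgN; apply: cvgM; [exact: cvg_cst|exact: cvg_id].
- rewrite -[X in _ --> X](mulr0 (- (c / mu ^+ 2))).
  apply: cvgM; first exact: cvg_cst.
  apply: (@cvg_comp _ _ _ (fun x : R => mu * x)
    (fun z => (1 + z) * expR (- z)) _ (pinfty_nbhs R)).
    exact: gt0_cvgMry.
  exact: cvg_addr1_mul_expRN.
- by apply/cvg_at_right_filter; exact: cF.
- by move=> x _; rewrite derive1E; exact: derive_val.
Qed.

(** Tilting the density by e^(s x) gives lam^2 x e^(- (lam - s) x) on the half-line, whose rate lam
    - s is positive. *)
Lemma erlang2_mgf d (T : measurableType d) (R : realType)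
    (P : probability T R) (X : {RV P >-> R}) (lam s : R) :
  s < lam -> erlang2_distributed X lam ->
  (\int[P]_x (expR (s * X x))%:E = ((lam / (lam - s)) ^+ 2)%:E)%E.
Proof.
move=> slam distX.
transitivity (\int[lebesgue_measure]_y (erlang2_pdf lam y * expR (s * y))%:E)%E.
  under eq_integral do rewrite -[expR _]mul1r.
  apply: (ge0_integral_weighted_transfer _ _ _ _ _ _ _ P lebesgue_measure X id
    (cst 1) (erlang2_pdf lam) _ _ _ _ _ _ _ (fun z => expR (s * z))) => //.
  - exact: measurable_erlang2_pdf.
  - exact: erlang2_pdf_ge0.
  - move=> B mB; transitivity (P (X @^-1` B)).
      rewrite -[X in P X]setIT -integral_indic//.
        by apply: eq_integral => x _; rewrite /= mul1r.
      rewrite -[X in measurable X]setTI; exact: measurable_funP.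
    rewrite distX// [LHS]integral_mkcond; apply: eq_integral => y _.
    by rewrite patchE indicE; case: ifP; rewrite ?mulr1 ?mulr0.
  - by apply: measurableT_comp => //; exact: measurable_funM.
rewrite expr_div_n -(integral_mulr_expRN _ (lam ^+ 2))//; last 2 first.
  by rewrite sqr_ge0.
  by rewrite subr_gt0.
rewrite [RHS]integral_mkcond; apply: eq_integral => y _.
rewrite patchE mem_setE in_itv/= andbT /erlang2_pdf.
case: ifP => _; last by rewrite mul0r.
rewrite -mulrA -expRD; congr (_ * expR _)%:E.
by ring.
Qed.

(** * Chernoff bounds for the tails *)

(** Markov's inequality for e^(s S), S being the sum. The sign of [s] is left free: a positive [s]
    controls the upper tail, a negative one the lower tail. *)
Lemma erlang2_sum_chernoff d (T : measurableType d) (R : realType)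
    (P : probability T R) (n : nat) (X : 'I_n -> {RV P >-> R}) (lam s a : R) :
  s < lam -> (forall m, erlang2_distributed (X m) lam) ->
  mutually_independent X ->
  measurable [set w | a <= s * \sum_(m < n) X m w] /\
  (P [set w | (a <= s * \sum_(m < n) X m w)%R]
    <= ((lam / (lam - s)) ^+ (2 * n) * expR (- a))%:E)%E.
Proof.
move=> slam distX indX; set A := [set w | _].
have mS : measurable_fun setT (fun w => s * \sum_(m < n) X m w).
  apply: measurable_funM => //; apply: measurable_sum => m.
  exact: measurable_funP.
have mA : measurable A.
  rewrite (_ : A = setT `&` (fun w => s * \sum_(m < n) X m w) @^-1` `[a, +oo[).
    exact: mS.
  by apply/seteqP; split => w /=; rewrite in_itv/= andbT => // -[].
split => //.
have mgfE : (\int[P]_w (expR (s * \sum_(m < n) X m w))%:E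
    = ((lam / (lam - s)) ^+ (2 * n))%:E)%E.
  under eq_integral do rewrite mulr_sumr expR_sum.
  rewrite (mutually_independent_ge0_integral_prod _ _ _ _ _ X
    (fun _ z => expR (s * z)))//.
  - under eq_bigr do rewrite (erlang2_mgf _ _ _ _ _ _ _ slam)//.
    by rewrite prodEFin prodr_const card_ord exprM.
  - by move=> m; apply: measurableT_comp => //; exact: measurable_funM.
  - by move=> m; rewrite (erlang2_mgf _ _ _ _ _ _ _ slam)// ltry.
rewrite EFinM -mgfE muleC -ge0_integralZl//; last first.
  by apply/measurable_EFinP; apply: measurableT_comp.
rewrite -[X in P X]setIT -integral_indic//; apply: ge0_le_integral => //.
- by apply/measurable_EFinP; apply: measurable_indic.
- apply/measurable_EFinP; apply: measurable_funM => //.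
  by apply: measurableT_comp.
- move=> w _; rewrite -EFinM lee_fin -expRD indicE.
  have [|_] := boolP (w \in A); last exact: expR_ge0.
  (* On the event, e^(s S - a) >= 1 + (s S - a) >= 1, so it dominates the indicator. *)
  rewrite inE /A /= => aS; apply: le_trans (expR_ge1Dx _).
  by rewrite lerDl addrC subr_ge0.
Qed.

Lemma erlang2_mean_deviation d (T : measurableType d) (R : realType)
    (P : probability T R) (n : nat) (X : 'I_n -> {RV P >-> R}) (lam a : R) :
  (0 < n)%N -> 0 < lam -> 0 <= a < 1 ->
  (forall m, erlang2_distributed (X m) lam) -> mutually_independent X ->
  let B := [set w | 2 * a / lam
              < `|(n%:R)^-1 * (\sum_(m < n) X m w) - 2 / lam| ] in
  measurable B /\
  (P B <= ((1 - a) ^+ (2 * n) * expR (2 * n%:R * a)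
           + (1 + a) ^+ (2 * n) * expR (- (2 * n%:R * a)))%:E)%E.
Proof.
move=> n0 lam0 /andP[a0 a1] distX indX B.
have nR0 : 0 < n%:R :> R by rewrite ltr0n.
have nR_neq0 : n%:R != 0 :> R by rewrite gt_eqF.
have lam_neq0 : lam != 0 by rewrite gt_eqF.
have a1_neq0 : 1 - a != 0 by rewrite gt_eqF// subr_gt0.
have a1D_neq0 : 1 + a != 0 by rewrite gt_eqF// ltr_wpDr.
(* The optimal Chernoff parameters for the two tails. *)
pose s1 := - (lam * (a / (1 - a))); pose s2 := lam * (a / (1 + a)).
have q1 : 0 <= a / (1 - a) by rewrite divr_ge0// subr_ge0 ltW.
have q2 : 0 <= a / (1 + a) by rewrite divr_ge0// addr_ge0.
have s1lam : s1 < lam by rewrite /s1; nra.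
have s2lam : s2 < lam.
  rewrite /s2 -[ltRHS]mulr1 ltr_pM2l// ltr_pdivrMr ?mul1r; lra.
(* Each level is the parameter times its threshold: s1 2n(1 - a)/lam = - 2na and s2 2n(1 + a)/lam =
   2na. *)
have [mU PU] := erlang2_sum_chernoff _ _ _ _ _ X lam s1
  (- (2 * n%:R * a)) s1lam distX indX.
have [mV PV] := erlang2_sum_chernoff _ _ _ _ _ X lam s2
  (2 * n%:R * a) s2lam distX indX.
(* The choices give lam - s1 = lam / (1 - a) and lam - s2 = lam / (1 + a). *)
have e1 : lam / (lam - s1) = 1 - a.
  by rewrite /s1; field; rewrite a1_neq0 /= (_ : _ - _ = lam)//; ring.
have e2 : lam / (lam - s2) = 1 + a.
  by rewrite /s2; field; rewrite a1D_neq0 /= (_ : _ - _ = lam)//; ring.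
rewrite e1 opprK in PU; rewrite e2 in PV.
set U := [set w | _] in mU PU; set V := [set w | _] in mV PV.
have mS : measurable_fun setT
    (fun w => `|(n%:R)^-1 * (\sum_(m < n) X m w) - 2 / lam|).
  apply: measurableT_comp => //; apply: measurable_funB => //.
  apply: measurable_funM => //; apply: measurable_sum => m.
  exact: measurable_funP.
have mB : measurable B.
  rewrite (_ : B = setT `&` (fun w =>
      `|(n%:R)^-1 * (\sum_(m < n) X m w) - 2 / lam|) @^-1` `]2 * a / lam, +oo[).
    exact: mS.
  by apply/seteqP; split => w /=; rewrite in_itv/= andbT => // -[].
split => //; rewrite EFinD.
apply: (@le_trans _ _ (P U + P V)%E); last exact: leeD.
apply: le_trans (measureU2 _ mU mV).
apply: le_measure; rewrite ?inE//; first exact: measurableU.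
move=> w; rewrite /B /U /V /=; set S := \sum_(m < n) X m w.
(* Scaling by n lam turns the deviation into lam S - 2n and its threshold into 2na. *)
have devE : n%:R * lam * ((n%:R)^-1 * S - 2 / lam) = lam * S - 2 * n%:R.
  by field; rewrite lam_neq0.
have thrE : n%:R * lam * (2 * a / lam) = 2 * n%:R * a by field.
rewrite real_ltr_normr ?num_real// => /orP[h|h].
- right.
  have {}h : 2 * n%:R * (1 + a) <= lam * S.
    have := ltW h; rewrite -(ler_pM2l (mulr_gt0 nR0 lam0)) devE thrE; lra.
  have -> : 2 * n%:R * a = (2 * n%:R * (1 + a)) * (a / (1 + a)) by field.
  have -> : s2 * S = (lam * S) * (a / (1 + a)) by rewrite /s2; ring.
  exact: ler_wpM2r.
- left.
  have {}h : lam * S <= 2 * n%:R * (1 - a).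
    have := ltW h.
    rewrite -(ler_pM2l (mulr_gt0 nR0 lam0)) mulrN devE thrE; lra.
  have -> : 2 * n%:R * a = (2 * n%:R * (1 - a)) * (a / (1 - a)) by field.
  have -> : s1 * S = - ((lam * S) * (a / (1 - a))) by rewrite /s1; ring.
  by rewrite lerN2 ler_wpM2r.
Qed.

(** * Estimates of [Psi] and its limit *)

(** With [y] half the exponent, e^(2y) >= (1 + y)^2. The square supplies the quadratic term that 1 +
    x <= e^x alone misses. *)
Lemma ler_addr1_expR_quad (R : realType) (a : R) : 0 <= a <= 1 ->
  1 + a <= expR (a - a ^+ 2 / 8).
Proof.
move=> /andP[a0 a1]; pose y := (a - a ^+ 2 / 8) / 2.
have -> : a - a ^+ 2 / 8 = y + y by rewrite /y; field.
rewrite expRD; have := expR_ge1Dx y.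
have y0 : 0 <= 1 + y by rewrite /y; nra.
move=> /(fun h => ler_pM y0 y0 h h); apply: le_trans.
(* As a <= 1, (1 - a/8)^2 >= 49/64 >= 1/2, which makes the coefficient of a^2 below nonnegative. *)
have h : 7/8 * (7/8) <= (1 - a / 8) * (1 - a / 8) by apply: ler_pM; lra.
have -> : (1 + y) * (1 + y)
    = 1 + a + a ^+ 2 * (((1 - a / 8) * (1 - a / 8)) / 4 - 8^-1).
  by rewrite /y; field.
by rewrite lerDl mulr_ge0 ?sqr_ge0//; lra.
Qed.

(** The same squaring: y^2 >= a^2/4 outweighs the loss a^2/8. *)
Lemma ler_subr1_expR_quad (R : realType) (a : R) : 0 <= a <= 1 ->
  1 - a <= expR (- a - a ^+ 2 / 8).
Proof.
move=> /andP[a0 a1]; pose y := - (a + a ^+ 2 / 8) / 2.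
have -> : - a - a ^+ 2 / 8 = y + y by rewrite /y; field.
rewrite expRD; have := expR_ge1Dx y.
have y0 : 0 <= 1 + y by rewrite /y; nra.
move=> /(fun h => ler_pM y0 y0 h h); apply: le_trans.
rewrite /y; nra.
Qed.

(** The relative deviation: ln n / (lam sqrt n) is this fraction of the mean 2/lam. *)
Definition Psi_scale (R : realType) (n : nat) : R :=
  ln (n%:R : R) / (2 * Num.sqrt (n%:R : R)).

Lemma Psi_scaleE (R : realType) (n : nat) : (0 < n)%N ->
  2 * n%:R * Psi_scale R n = Num.sqrt n%:R * ln n%:R.
Proof.
move=> n0; have r0 : 0 < Num.sqrt n%:R :> R by rewrite sqrtr_gt0 ltr0n.
rewrite /Psi_scale -[X in 2 * X * _](@sqr_sqrtr _ (n%:R : R)) ?ler0n//.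
by field; rewrite gt_eqF.
Qed.

Lemma Psi_scale_sqr (R : realType) (n : nat) : (0 < n)%N ->
  2 * n%:R * Psi_scale R n ^+ 2 = ln (n%:R : R) ^+ 2 / 2.
Proof.
move=> n0; have r0 : 0 < Num.sqrt n%:R :> R by rewrite sqrtr_gt0 ltr0n.
rewrite /Psi_scale -[X in 2 * X * _](@sqr_sqrtr _ (n%:R : R)) ?ler0n//.
by field; rewrite gt_eqF.
Qed.

(** The scale equals ln(sqrt n) / sqrt n, and ln x < x. *)
Lemma Psi_scale_ge0_lt1 (R : realType) (n : nat) : (0 < n)%N ->
  0 <= Psi_scale R n < 1.
Proof.
move=> n0; have r0 : 0 < Num.sqrt n%:R :> R by rewrite sqrtr_gt0 ltr0n.
have -> : Psi_scale R n = ln (Num.sqrt n%:R) / Num.sqrt n%:R.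
  rewrite /Psi_scale -[X in ln X](@sqr_sqrtr _ (n%:R : R)) ?ler0n// lnXn//.
  by rewrite mulr2n; field; rewrite gt_eqF.
apply/andP; split; last by rewrite ltr_pdivrMr// mul1r ln_sublinear.
rewrite divr_ge0 ?sqrtr_ge0// ln_ge0//.
by rewrite -[leLHS]sqrtr1 ler_wsqrtr// ler1n.
Qed.

(** Writes n^(1 + sqrt n) and n^(1 - sqrt n) as n e^(2na) and n e^(- 2na). This exhibits the
    Chernoff bound for one index, multiplied by the n terms of the union bound. *)
Lemma PsiE (R : realType) (n : nat) : (0 < n)%N ->
  Psi R n = Num.max 0 (1 - n%:R *
    ((1 - Psi_scale R n) ^+ (2 * n) * expR (2 * n%:R * Psi_scale R n)
     + (1 + Psi_scale R n) ^+ (2 * n) * expR (- (2 * n%:R * Psi_scale R n)))).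
Proof.
move=> n0; have nR0 : 0 < n%:R :> R by rewrite ltr0n.
rewrite Psi_scaleE// /Psi -/(Psi_scale R n) /powR gt_eqF//.
rewrite [(1 + _) * ln _]mulrDl [(1 - _) * ln _]mulrBl mul1r !expRD lnK ?posrE//.
congr (Num.max 0 _); ring.
Qed.

Lemma Psi_le1 (R : realType) (n : nat) : (0 < n)%N -> Psi R n <= 1.
Proof.
move=> n0; have /andP[a0 a1] := Psi_scale_ge0_lt1 R n n0.
rewrite PsiE// ge_max ler01 /= gerBl mulr_ge0// addr_ge0// mulr_ge0 ?expR_ge0//.
  by rewrite exprn_ge0// subr_ge0 ltW.
by rewrite exprn_ge0// addr_ge0.
Qed.

Lemma Psi_ge (R : realType) (n : nat) : (0 < n)%N ->
  1 - 2 * expR (ln n%:R - ln n%:R ^+ 2 / 16) <= Psi R n.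
Proof.
move=> n0; have /andP[a0 a1] := Psi_scale_ge0_lt1 R n n0.
have nR0 : 0 < n%:R :> R by rewrite ltr0n.
rewrite PsiE// le_max; apply/orP; right.
set a := Psi_scale R n in a0 a1 *.
set c := expR (- (ln (n%:R : R) ^+ 2 / 16)).
have a01 : 0 <= a <= 1 by rewrite a0 ltW.
(* By [Psi_scale_sqr], 2n a^2/8 = (ln n)^2/16, whence the factor [c]. For b = - a and b = a the
   other exponential cancels the remaining one. *)
have expE (b : R) : expR (b - a ^+ 2 / 8) ^+ (2 * n) = expR (2 * n%:R * b) * c.
  rewrite -expRM_natl -expRD natrM; congr expR.
  have := Psi_scale_sqr R n n0; rewrite -/a => a2.
  have -> : ln (n%:R : R) ^+ 2 / 16 = (ln (n%:R : R) ^+ 2 / 2) / 8 by field.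
  by rewrite -a2; field.
have t1 : (1 - a) ^+ (2 * n) * expR (2 * n%:R * a) <= c.
  apply: (@le_trans _ _
    (expR (- a - a ^+ 2 / 8) ^+ (2 * n) * expR (2 * n%:R * a))).
    rewrite ler_wpM2r ?expR_ge0// lerXn2r ?nnegrE ?expR_ge0 ?subr_ge0 ?(ltW a1)//.
    exact: ler_subr1_expR_quad.
  by rewrite expE mulrAC -expRD mulrN addNr expR0 mul1r.
have t2 : (1 + a) ^+ (2 * n) * expR (- (2 * n%:R * a)) <= c.
  apply: (@le_trans _ _
    (expR (a - a ^+ 2 / 8) ^+ (2 * n) * expR (- (2 * n%:R * a)))).
    rewrite ler_wpM2r ?expR_ge0// lerXn2r ?nnegrE ?expR_ge0 ?addr_ge0//.
    exact: ler_addr1_expR_quad.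
  by rewrite expE mulrAC -expRD subrr expR0 mul1r.
rewrite lerD2l lerN2 expRD lnK ?posrE// -/c [leRHS]mulrCA ler_pM2l//.
by rewrite [leRHS]mulr_natl mulr2n lerD.
Qed.

Lemma cvg_Psi (R : realType) : (Psi R : nat -> R) @ \oo --> (1 : R).
Proof.
apply/cvgrPdist_le => e e0; near=> n.
have n0 : (0 < n)%N by near: n; exact: nbhs_infty_gt.
have nR0 : 0 < n%:R :> R by rewrite ltr0n.
rewrite ger0_norm ?subr_ge0 ?Psi_le1//.
suff : expR (ln n%:R - ln n%:R ^+ 2 / 16) <= e / 2.
  by have := Psi_ge R n n0; lra.
have L32 : 32 <= ln (n%:R : R).
  rewrite -ler_expR lnK ?posrE//.
  by near: n; exact: nbhs_infty_ger.
(* From L = ln n >= 32 follows L^2/16 >= 2L, so the exponent is at most - L and the bound 1/n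
   results. *)
apply: (@le_trans _ _ (expR (- ln n%:R))); first by rewrite ler_expR; nra.
rewrite expRN lnK ?posrE// -[leRHS]invrK lef_pV2 ?posrE ?invr_gt0 ?divr_gt0//.
by near: n; exact: nbhs_infty_ger.
Unshelve. all: by end_near. Qed.

(** * Union bound and conclusion *)

Lemma measure_bigsetU_le d (T : measurableType d) (R : realType)
    (mu : {measure set T -> \bar R}) (n : nat) (B : 'I_n -> set T)
    (c : 'I_n -> \bar R) :
  (forall k, measurable (B k)) -> (forall k, mu (B k) <= c k)%E ->
  (mu (\big[setU/set0]_(k < n) B k) <= \sum_(k < n) c k)%E.
Proof.
move=> mB Bc.
(* Measurability of the partial unions is carried along because subadditivity for two sets asks for
   it. *)
suff [] : measurable (\big[setU/set0]_(k < n) B k) /\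
    (mu (\big[setU/set0]_(k < n) B k) <= \sum_(k < n) c k)%E by [].
apply: (big_ind2 (fun C x => measurable C /\ (mu C <= x)%E)) => //.
  by rewrite measure0.
move=> C x D y [mC Cx] [mD Dy]; split; first exact: measurableU.
exact: le_trans (measureU2 _ mC mD) (leeD Cx Dy).
Qed.

Theorem theorem5 (R : realType) (d : measure_display) (T : measurableType d)
  (P : probability T R) (n : nat) (lam : R)
  (tau : 'I_n -> 'I_n -> {RV P >-> R}) :
  (2 <= n)%N -> 0 < lam ->
  (forall k m, erlang2_distributed (tau k m) lam) ->
  (forall k, mutually_independent (tau k)) ->
  let Tk := fun (k : 'I_n) (w : T) =>
    (n%:R)^-1 * (\sum_(m < n) tau k m w) - 2 / lam in
  (fine (P [set w | \big[Num.max/0]_(k < n) `|Tk k w|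
                    <= ln (n%:R : R) / (lam * Num.sqrt (n%:R : R))])
     >= Psi R n)
  /\ ((Psi R : nat -> R) @ \oo --> (1 : R)).
Proof.
move=> n2 lam0 distT indT Tk; split; last exact: cvg_Psi.
have n0 : (0 < n)%N by exact: ltnW.
have r0 : 0 < Num.sqrt n%:R :> R by rewrite sqrtr_gt0 ltr0n.
have a01 := Psi_scale_ge0_lt1 R n n0.
have /andP[a0 _] := a01.
have -> : ln (n%:R : R) / (lam * Num.sqrt n%:R) = 2 * Psi_scale R n / lam.
  by rewrite /Psi_scale; field; rewrite !gt_eqF.
rewrite PsiE//; move: (Psi_scale R n) a0 a01 => a a0 a01.
pose B k := [set w | 2 * a / lam < `|Tk k w|].
set q := (X in 1 - n%:R * X).
have mPB k : measurable (B k) /\ (P (B k) <= q%:E)%E.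
  exact: erlang2_mean_deviation.
have mB k := (mPB k).1; have PB k := (mPB k).2.
(* The event is the complement of the union of the single deviations, to which the union bound
   applies whatever the dependence between different [k]. *)
have -> : [set w | \big[Num.max/0]_(k < n) `|Tk k w| <= 2 * a / lam]
    = ~` (\big[setU/set0]_(k < n) B k).
  rewrite -bigcup_seq; apply/seteqP; split => w /=.
    move=> /bigmax_leP[_ wle] [k _]; rewrite /B /=.
    by rewrite ltNge wle.
  (* The maximum starts from the default value 0, so the threshold must also be shown
     nonnegative. *)
  move=> wB; apply/bigmax_leP; split; first by rewrite divr_ge0 ?mulr_ge0// ltW.
  move=> k _; rewrite leNgt; apply/negP => wBk; apply: wB; exists k => //=.
  exact: mem_index_enum.
have mU : measurable (\big[setU/set0]_(k < n) B k).
  by apply: bigsetU_measurable.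
(* The bound by 0 in [Psi] is nonnegativity of a probability; the other one passes to the
   complement. *)
rewrite ge_max fine_ge0//= probability_setC// fineB ?fin_num_measure//.
rewrite lerD2l lerN2 -lee_fin fineK ?fin_num_measure//.
apply: le_trans (measure_bigsetU_le _ _ _ _ _ _ _ mB PB) _.
by rewrite sumEFin lee_fin sumr_const card_ord mulr_natl.
Qed.
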